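(* Let $f\in C^1(\mathbb{R})$, let $u_L,u_R\in\mathbb{R}$ and $\varepsilon>0$. Assume that $f'$ is Lipschitz continuous on $[\min\{u_L,u_R\},\max\{u_L,u_R\}]$ if $u_L\neq u_R$ (no further assumption beyond $f\in C^1(\mathbb{R})$ if $u_L=u_R$). Then there exists a unique function $u\in C^2(\mathbb{R})$ satisfying \[ \varepsilon u''(\xi)=\big(f'(u(\xi))-\xi\big)u'(\xi)\quad\text{for all }\xi\in\mathbb{R},\qquad \lim_{\xi\to-\infty}u(\xi)=u_L,\quad \lim_{\xi\to+\infty}u(\xi)=u_R. \]
   Context: This boundary value problem describes self-similar solutions $U(x,t)=u(x/t)$ of the Dafermos regularization $U_t+f(U)_x=\varepsilon t U_{xx}$ of the scalar conservation law $U_t+f(U)_x=0$ with Riemann initial data ($U(x,0)=u_L$ for $x<0$, $U(x,0)=u_R$ for $x>0$). Solutions are understood in the classical sense, i.e. $u\in C^2(\mathbb{R})$. *)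

(* Defs.v *)
From Stdlib Require Import Reals.
From Coquelicot Require Import Coquelicot.
Open Scope R_scope.

Definition is_C1 (f : R -> R) : Prop :=
  (forall x, ex_derive f x) /\ (forall x, continuous (Derive f) x).

Definition is_C2 (u : R -> R) : Prop :=
  (forall x, ex_derive u x) /\ (forall x, ex_derive (Derive u) x) /\
  (forall x, continuous (Derive_n u 2) x).

Definition lipschitz_on (g : R -> R) (a b : R) : Prop :=
  exists L : R, forall x y, a <= x <= b -> a <= y <= b ->
    Rabs (g x - g y) <= L * Rabs (x - y).

Definition dafermos_solution (f : R -> R) (eps uL uR : R) (u : R -> R) : Prop :=
  is_C2 u /\
  (forall xi, eps * Derive_n u 2 xi = (Derive f (u xi) - xi) * Derive u xi) /\
  is_lim u m_infty uL /\ is_lim u p_infty uR.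

(* Main.v *)
(* Clamping the argument of f' to the interval spanned by uL and uR, put
   b(u) = f'(clamp u) / eps, which is bounded and Lipschitz, and k = 1 / eps. The equation
   u'' = (b(u) - k x) u' means u' = p e^W with W' = b(u) - k x, so every solution is monotone,
   a solution of the boundary value problem never leaves the interval, and clamping is harmless.
   As u' has Gaussian decay, the solution with u(0) = c, u'(0) = p depends on (c, p) in a
   locally Lipschitz way uniformly on the line, hence so do its limits Phi(c, p) at +oo and
   Psi(c, p) at -oo.
   For two solutions with difference w, J = w' - (B(u1) - B(u2)) + k x w (where B' = b) satisfies
   J' = k w, and J = w' where w = 0, so J has no positive local maximum. Since J tends to 0 at
   infinity when the limits agree, the boundary value problem has at most one solution; on a
   half line the same argument shows that Phi(c, p) is strictly increasing in p. Thus
   Phi(c, q(c)) = uR defines a continuous q, and the intermediate value theorem solves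
   Psi(c, q(c)) = uL. *)
Require Import Defs.
From Stdlib Require Import Reals.
From Coquelicot Require Import Coquelicot.
From Stdlib Require Import Lra ClassicalEpsilon FunctionalExtensionality.
Open Scope R_scope.

(** * Calculus preliminaries: monotonicity, geometric limits, the exponential *)

Lemma nondecreasing_of_derive (h dh : R -> R) (a b : R) :
  a <= b -> (forall x, a <= x <= b -> is_derive h x (dh x)) ->
  (forall x, a <= x <= b -> 0 <= dh x) -> h a <= h b.
Proof.
intros Hab Hd Hpos.
destruct (MVT_gen h a b dh) as [c [Hc Heq]].
- rewrite Rmin_left, Rmax_right by lra. intros x Hx. apply Hd; lra.
- rewrite Rmin_left, Rmax_right by lra. intros x Hx.
  apply continuity_pt_filterlim, (ex_derive_continuous h x).
  exists (dh x). apply Hd; lra.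
- rewrite Rmin_left, Rmax_right in Hc by lra.
  specialize (Hpos c Hc). nra.
Qed.

(** Both [g - h] and [g + h] are nondecreasing. The estimates below exhibit an explicit majorant [g]
    in place of bounding an integral. *)
Lemma variation_bound (h dh g dg : R -> R) (a b : R) :
  a <= b -> (forall x, a <= x <= b -> is_derive h x (dh x)) ->
  (forall x, a <= x <= b -> is_derive g x (dg x)) ->
  (forall x, a <= x <= b -> Rabs (dh x) <= dg x) ->
  Rabs (h b - h a) <= g b - g a.
Proof.
intros Hab Hh Hg Hle.
assert (H1 : g a - h a <= g b - h b).
{ apply (nondecreasing_of_derive (fun x => g x - h x) (fun x => dg x - dh x)); auto.
  - intros x Hx. apply (is_derive_minus (V:=R_NormedModule)); auto.
  - intros x Hx. specialize (Hle x Hx). apply Rabs_le_between in Hle. lra. }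
assert (H2 : g a + h a <= g b + h b).
{ apply (nondecreasing_of_derive (fun x => g x + h x) (fun x => dg x + dh x)); auto.
  - intros x Hx. apply (is_derive_plus (V:=R_NormedModule)); auto.
  - intros x Hx. specialize (Hle x Hx). apply Rabs_le_between in Hle. lra. }
apply Rabs_le_between. lra.
Qed.

Lemma is_derive_reflect (h : R -> R) (x l : R) :
  is_derive h (- x) l -> is_derive (fun y => h (- y)) x (- l).
Proof.
intros H.
replace (- l) with (scal (-1) l) by (unfold scal; simpl; unfold mult; simpl; ring).
apply (is_derive_comp h (fun y => - y)); auto.
auto_derive; auto.
Qed.

Lemma is_derive_primitive (h : R -> R) (x : R) :
  (forall y, continuous h y) -> is_derive (fun y => RInt h 0 y) x (h x).
Proof.
intros Hc. apply (is_derive_RInt h (fun y => RInt h 0 y) 0 x); [|apply Hc].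
exists (mkposreal 1 Rlt_0_1). intros y _. apply (RInt_correct (V:=R_CompleteNormedModule)).
apply (ex_RInt_continuous (V:=R_CompleteNormedModule)). intros z _. apply Hc.
Qed.

Lemma lipschitz_continuous (h : R -> R) (L : R) :
  (forall x y, Rabs (h x - h y) <= L * Rabs (x - y)) -> forall x, continuous h x.
Proof.
intros HL x. apply continuity_pt_filterlim.
intros e He. exists (e / (Rabs L + 1)).
assert (Hp := Rabs_pos L). split.
- apply Rdiv_lt_0_compat; lra.
- simpl. unfold R_dist. intros y [_ Hy].
  apply Rle_lt_trans with (1 := HL y x).
  apply Rle_lt_trans with ((Rabs L + 1) * Rabs (y - x)).
  + apply Rmult_le_compat_r. apply Rabs_pos. assert (H := Rle_abs L). lra.
  + apply Rmult_lt_compat_l with (r := Rabs L + 1) in Hy; [|lra].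
    replace ((Rabs L + 1) * (e / (Rabs L + 1))) with e in Hy by (field; lra). exact Hy.
Qed.

(** The supremum of the lower ends works. The [sig] type makes limits available as data, so that
    functions can be defined pointwise from them. *)
Lemma separating_real {A : Type} (i0 : A) (lo hi : A -> R) :
  (forall i j, lo i <= hi j) -> {l : R | forall i, lo i <= l <= hi i}.
Proof.
intros H.
destruct (completeness (fun y => exists i, y = lo i)) as [l [Hub Hlub]].
- exists (hi i0). intros y [i ->]. apply H.
- exists (lo i0), i0. reflexivity.
- exists l. intros i. split.
  + apply Hub. exists i. reflexivity.
  + apply Hlub. intros y [j ->]. apply H.
Qed.

Lemma le_of_geometric (a b K : R) :
  (forall n, a <= b + K / 2 ^ n) -> a <= b.
Proof.
intros H. apply Rnot_lt_le. intros Hlt.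
assert (Hl : is_lim_seq (fun n => b + K * (/ 2) ^ n) (b + K * 0)).
{ apply (is_lim_seq_plus' (fun _ => b) _ b (K * 0)).
  - apply is_lim_seq_const.
  - apply (is_lim_seq_scal_l _ K 0). apply is_lim_seq_geom. rewrite Rabs_pos_eq; lra. }
assert (Hle : Rbar_le a (b + K * 0)).
{ apply (is_lim_seq_le (fun _ => a) (fun n => b + K * (/ 2) ^ n) a (b + K * 0)).
  - intros n. specialize (H n). unfold Rdiv in H. rewrite <- pow_inv in H. exact H.
  - apply is_lim_seq_const.
  - exact Hl. }
simpl in Hle. lra.
Qed.

(** The tail of the series [K / 2 ^ j] from [n] on is [2 * K / 2 ^ n], so the intervals of that
    radius around the [s n] are nested and share a point. *)
Lemma geometric_limit (s : nat -> R) (K : R) :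
  (forall n, Rabs (s (S n) - s n) <= K / 2 ^ n) ->
  {l : R | forall n, Rabs (s n - l) <= 2 * K / 2 ^ n}.
Proof.
intros H.
assert (Hp : forall n, 0 < 2 ^ n) by (intros n; apply pow_lt; lra).
assert (HK : 0 <= K).
{ specialize (H O). assert (Ha := Rabs_pos (s 1%nat - s 0%nat)). simpl in H. lra. }
assert (Hstep : forall n, 2 * K / 2 ^ (S n) = 2 * K / 2 ^ n - K / 2 ^ n).
{ intros n. simpl. specialize (Hp n). field. lra. }
assert (Hd : forall n m, s n - 2 * K / 2 ^ n <= s (m + n)%nat - 2 * K / 2 ^ (m + n) /\
    s (m + n)%nat + 2 * K / 2 ^ (m + n) <= s n + 2 * K / 2 ^ n).
{ intros n m. induction m as [|m IH]; simpl Nat.add; [lra|].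
  rewrite Hstep. specialize (H (m + n)%nat). apply Rabs_le_between in H. lra. }
assert (Hq : forall n, 0 <= 2 * K / 2 ^ n).
{ intros n. apply Rmult_le_pos; [lra|]. apply Rlt_le, Rinv_0_lt_compat, Hp. }
destruct (separating_real O (fun n => s n - 2 * K / 2 ^ n) (fun n => s n + 2 * K / 2 ^ n))
  as [l Hl].
- intros i j. assert (H1 := Hd i j). assert (H2 := Hd j i).
  replace (j + i)%nat with (i + j)%nat in H1 by apply Nat.add_comm.
  assert (H3 := Hq (i + j)%nat). lra.
- exists l. intros n. specialize (Hl n). apply Rabs_le_between. lra.
Qed.

Lemma exp_nondecreasing (x y : R) : x <= y -> exp x <= exp y.
Proof.
intros [H | ->]; [apply Rlt_le, exp_increasing; auto | apply Rle_refl].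
Qed.

Lemma exp_lipschitz (x y m : R) :
  x <= m -> y <= m -> Rabs (exp x - exp y) <= exp m * Rabs (x - y).
Proof.
assert (Hw : forall x y, x <= y -> y <= m -> Rabs (exp y - exp x) <= exp m * Rabs (y - x)).
{ clear x y. intros x y Hxy Hy. rewrite (Rabs_pos_eq (y - x)) by lra.
  replace (exp m * (y - x)) with (exp m * y - exp m * x) by ring.
  apply (variation_bound exp exp (fun t => exp m * t) (fun _ => exp m) x y Hxy).
  - intros t _. apply is_derive_exp.
  - intros t _. auto_derive; auto; ring.
  - intros t Ht. rewrite Rabs_pos_eq by apply Rlt_le, exp_pos. apply exp_nondecreasing; lra. }
intros Hx Hy. destruct (Rle_lt_dec x y).
- rewrite Rabs_minus_sym, (Rabs_minus_sym x y). auto.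
- apply Hw; lra.
Qed.

(** Half of the decay rate pays for the linear factor; this is why Gaussian decay is relaxed below
    to the rate [exp (- (2 * x))]. *)
Lemma mul_exp_neg_le (x : R) : x * exp (- (2 * x)) <= exp (- x).
Proof.
assert (H := exp_ineq1_le x).
replace (exp (- x)) with (exp x * exp (- (2 * x))) by (rewrite <- exp_plus; f_equal; ring).
apply Rmult_le_compat_r; [apply Rlt_le, exp_pos | lra].
Qed.

(** * The Picard operator: reflection, Gaussian decay, contraction *)

Definition bounded_lipschitz (b : R -> R) (M L : R) : Prop :=
  0 <= M /\ 0 <= L /\ (forall y, Rabs (b y) <= M) /\
  (forall y z, Rabs (b y - b z) <= L * Rabs (y - z)).

(* [gauss M k * exp (- (2 * x))] dominates [exp (M * x - k * x ^ 2 / 2)]: complete the square. *)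
Definition gauss (M k : R) : R := exp ((M + 2) ^ 2 / (2 * k)).

(* The Picard operator, written with derivatives: [U = c + p * int_0 exp W]
   where [W = int_0 (b (u s) - k s) ds]. *)
Definition picard_step (b : R -> R) (k c p : R) (u U W : R -> R) : Prop :=
  U 0 = c /\ W 0 = 0 /\ (forall x, is_derive U x (p * exp (W x))) /\
  (forall x, is_derive W x (b (u x) - k * x)).

(* A fixed point of the Picard operator solves [u'' = (b u - k x) u'],
   [u 0 = c], [u' 0 = p]. *)
Definition profile (b : R -> R) (k c p : R) (u W : R -> R) : Prop :=
  picard_step b k c p u u W.

(* Its logarithmic derivative [2 A exp (- x)] is what makes the Picard operator a
   1/2-contraction, and it is bounded, so estimates pass to the limit at infinity. *)
Definition weight (A x : R) : R := exp (2 * A * (1 - exp (- x))).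

Lemma bounded_lipschitz_opp (b : R -> R) (M L : R) :
  bounded_lipschitz b M L -> bounded_lipschitz (fun y => - b y) M L.
Proof.
intros (HM & HL & Hb & Hl). repeat split; auto.
- intros y. rewrite Rabs_Ropp. apply Hb.
- intros y z. replace (- b y - - b z) with (- (b y - b z)) by ring.
  rewrite Rabs_Ropp. apply Hl.
Qed.

(** Under [x -> - x] the constant [k] is kept while [b] and [p] change sign, so estimates need to be
    made on the half line [0 <= x] only. *)
Lemma picard_step_reflect (b : R -> R) (k c p : R) (u U W : R -> R) :
  picard_step b k c p u U W ->
  picard_step (fun y => - b y) k c (- p)
    (fun x => u (- x)) (fun x => U (- x)) (fun x => W (- x)).
Proof.
intros (HU & HW & HdU & HdW). split; [|split; [|split]].
- rewrite Ropp_0; auto.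
- rewrite Ropp_0; auto.
- intros x. replace (- p * exp (W (- x))) with (- (p * exp (W (- x)))) by ring.
  apply is_derive_reflect, HdU.
- intros x. replace (- b (u (- x)) - k * x) with (- (b (u (- x)) - k * - x)) by ring.
  apply is_derive_reflect, HdW.
Qed.

Lemma exponent_bound (b : R -> R) (M L k c p : R) (u U W : R -> R) (x : R) :
  bounded_lipschitz b M L -> picard_step b k c p u U W -> 0 <= x ->
  Rabs (W x + k * x ^ 2 / 2) <= M * x.
Proof.
intros (_ & _ & Hb & _) (_ & HW & _ & HdW) Hx.
replace (W x + k * x ^ 2 / 2) with ((W x + k * x ^ 2 / 2) - (W 0 + k * 0 ^ 2 / 2))
  by (rewrite HW; field).
replace (M * x) with (M * x - M * 0) by ring.
apply (variation_bound (fun y => W y + k * y ^ 2 / 2) (fun y => b (u y))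
  (fun y => M * y) (fun _ => M)); auto.
- intros y _. replace (b (u y)) with ((b (u y) - k * y) + k * y) by ring.
  apply (is_derive_plus (V:=R_NormedModule) W); [apply HdW|].
  auto_derive; auto; field.
- intros y _. auto_derive; auto; ring.
Qed.

Lemma gauss_bound (M k x : R) :
  0 < k -> exp (M * x - k * x ^ 2 / 2) <= gauss M k * exp (- (2 * x)).
Proof.
intros Hk. unfold gauss. rewrite <- exp_plus. apply exp_nondecreasing.
replace ((M + 2) ^ 2 / (2 * k) + - (2 * x)) with
  (M * x - k * x ^ 2 / 2 + (k * x - (M + 2)) ^ 2 / (2 * k)) by (field; lra).
assert (0 <= (k * x - (M + 2)) ^ 2 / (2 * k)); [|lra].
apply Rmult_le_pos; [apply pow2_ge_0|]. apply Rlt_le, Rinv_0_lt_compat; lra.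
Qed.

Lemma exp_exponent_le (b : R -> R) (M L k c p : R) (u U W : R -> R) (x : R) :
  0 < k -> bounded_lipschitz b M L -> picard_step b k c p u U W -> 0 <= x ->
  exp (W x) <= gauss M k * exp (- (2 * x)).
Proof.
intros Hk Hb Hs Hx.
apply Rle_trans with (2 := gauss_bound M k x Hk). apply exp_nondecreasing.
assert (H := exponent_bound b M L k c p u U W x Hb Hs Hx).
apply Rabs_le_between in H. lra.
Qed.

Lemma gauss_pos (M k : R) : 0 < gauss M k.
Proof. apply exp_pos. Qed.

Lemma weight_ge1 (A x : R) : 0 <= A -> 0 <= x -> 1 <= weight A x.
Proof.
intros HA Hx. unfold weight. replace 1 with (exp 0) at 1 by apply exp_0. apply exp_nondecreasing.
assert (exp (- x) <= 1) by (rewrite <- exp_0; apply exp_nondecreasing; lra). nra.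
Qed.

Lemma weight_le (A x : R) : 0 <= A -> weight A x <= exp (2 * A).
Proof.
intros HA. unfold weight. apply exp_nondecreasing. assert (H := exp_pos (- x)). nra.
Qed.

Lemma weight_incr (A x y : R) : 0 <= A -> x <= y -> weight A x <= weight A y.
Proof.
intros HA Hxy. unfold weight. apply exp_nondecreasing.
assert (exp (- y) <= exp (- x)) by (apply exp_nondecreasing; lra). nra.
Qed.

(** The exponents differ by at most [L * D * weight A x * x]. Multiplied by the Gaussian bound, the
    factor [x] is absorbed and the slopes differ by [A * D * weight A x * exp (- x)] plus a term
    from [p1 - p2]. The former is exactly the derivative of [D / 2 * weight A x], whence the factor
    1/2. *)
Lemma picard_contraction_pos (b : R -> R) (M L k P D c1 c2 p1 p2 : R)
  (u1 U1 W1 u2 U2 W2 : R -> R) :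
  0 < k -> bounded_lipschitz b M L -> Rabs p1 <= P -> 0 <= D ->
  picard_step b k c1 p1 u1 U1 W1 -> picard_step b k c2 p2 u2 U2 W2 ->
  (forall x, 0 <= x -> Rabs (u1 x - u2 x) <= D * weight (P * L * gauss M k) x) ->
  forall x, 0 <= x -> Rabs (U1 x - U2 x) <=
    (Rabs (c1 - c2) + gauss M k * Rabs (p1 - p2) + D / 2) * weight (P * L * gauss M k) x.
Proof.
intros Hk Hb HP HD H1 H2 Hu x Hx.
set (C := gauss M k). set (A := P * L * C).
assert (HC : 0 < C) by apply gauss_pos.
assert (HL : 0 <= L) by apply Hb.
assert (HP0 : 0 <= P) by (assert (H := Rabs_pos p1); lra).
assert (HA : 0 <= A) by (unfold A; repeat apply Rmult_le_pos; lra).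
(* The weight is nondecreasing, so on [[0, y]] its value at [y] serves as a constant and the
   majorant is linear. *)
assert (HW : forall y, 0 <= y -> Rabs (W1 y - W2 y) <= L * D * weight A y * y).
{ intros y Hy. destruct Hb as (_ & _ & _ & Hlip).
  destruct H1 as (_ & HW1 & _ & HdW1). destruct H2 as (_ & HW2 & _ & HdW2).
  replace (W1 y - W2 y) with ((W1 y - W2 y) - (W1 0 - W2 0)) by (rewrite HW1, HW2; ring).
  replace (L * D * weight A y * y) with
    (L * D * weight A y * y - L * D * weight A y * 0) by ring.
  apply (variation_bound (fun t => W1 t - W2 t)
    (fun t => (b (u1 t) - k * t) - (b (u2 t) - k * t))
    (fun t => L * D * weight A y * t) (fun _ => L * D * weight A y)); auto.
  - intros t _. apply (is_derive_minus (V:=R_NormedModule)); auto.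
  - intros t _. auto_derive; auto; ring.
  - intros t Ht. replace (b (u1 t) - k * t - (b (u2 t) - k * t)) with (b (u1 t) - b (u2 t)) by ring.
    apply Rle_trans with (1 := Hlip _ _).
    rewrite Rmult_assoc. apply Rmult_le_compat_l; auto.
    apply Rle_trans with (1 := Hu t (proj1 Ht)).
    apply Rmult_le_compat_l; auto. apply weight_incr; auto; lra. }
assert (Hd : forall y, 0 <= y -> Rabs (p1 * exp (W1 y) - p2 * exp (W2 y)) <=
    A * D * weight A y * exp (- y) + C * Rabs (p1 - p2) * exp (- y)).
{ intros y Hy.
  replace (p1 * exp (W1 y) - p2 * exp (W2 y)) with
    (p1 * (exp (W1 y) - exp (W2 y)) + (p1 - p2) * exp (W2 y)) by ring.
  apply Rle_trans with (1 := Rabs_triang _ _). rewrite !Rabs_mult.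
  apply Rplus_le_compat.
  - assert (B1 := exponent_bound _ _ _ _ _ _ _ _ _ y Hb H1 Hy).
    assert (B2 := exponent_bound _ _ _ _ _ _ _ _ _ y Hb H2 Hy).
    apply Rabs_le_between in B1. apply Rabs_le_between in B2.
    assert (He : Rabs (exp (W1 y) - exp (W2 y)) <=
      exp (M * y - k * y ^ 2 / 2) * Rabs (W1 y - W2 y)) by (apply exp_lipschitz; lra).
    apply Rle_trans with (P * ((C * exp (- (2 * y))) * (L * D * weight A y * y))).
    + apply Rmult_le_compat; auto; try apply Rabs_pos.
      apply Rle_trans with (1 := He).
      apply Rmult_le_compat; auto; try apply Rabs_pos.
      * apply Rlt_le, exp_pos.
      * apply gauss_bound; auto.
    + replace (P * (C * exp (- (2 * y)) * (L * D * weight A y * y))) with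
        (A * D * weight A y * (y * exp (- (2 * y)))) by (unfold A; ring).
      apply Rmult_le_compat_l; [|apply mul_exp_neg_le].
      apply Rmult_le_pos; [apply Rmult_le_pos; auto | apply Rlt_le, exp_pos].
  - rewrite (Rabs_pos_eq (exp _)) by apply Rlt_le, exp_pos.
    replace (C * Rabs (p1 - p2) * exp (- y)) with (Rabs (p1 - p2) * (C * exp (- y))) by ring.
    apply Rmult_le_compat_l; [apply Rabs_pos|].
    apply Rle_trans with (1 := exp_exponent_le _ _ _ _ _ _ _ _ _ y Hk Hb H2 Hy).
    apply Rmult_le_compat_l; [lra|]. apply exp_nondecreasing; lra. }
destruct H1 as (HU1 & _ & HdU1 & _). destruct H2 as (HU2 & _ & HdU2 & _).
assert (Hv : Rabs ((U1 x - U2 x) - (U1 0 - U2 0)) <=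
  (D / 2 * weight A x - C * Rabs (p1 - p2) * exp (- x)) -
  (D / 2 * weight A 0 - C * Rabs (p1 - p2) * exp (- 0))).
{ apply (variation_bound (fun t => U1 t - U2 t)
    (fun t => p1 * exp (W1 t) - p2 * exp (W2 t))
    (fun t => D / 2 * weight A t - C * Rabs (p1 - p2) * exp (- t))
    (fun t => A * D * weight A t * exp (- t) + C * Rabs (p1 - p2) * exp (- t))); auto.
  - intros t _. apply (is_derive_minus (V:=R_NormedModule)); auto.
  - intros t _. unfold weight. auto_derive; auto. unfold Rminus. field.
  - intros t Ht. apply Hd; lra. }
rewrite HU1, HU2 in Hv. rewrite Ropp_0, exp_0 in Hv.
(* The negative terms are dropped, and [1 <= weight A x] puts the contributions of [c1 - c2] and
   [p1 - p2] under the weight. *)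
assert (Hw0 := weight_ge1 A 0 HA (Rle_refl 0)).
assert (Hwx := weight_ge1 A x HA Hx).
assert (Hex := exp_pos (- x)).
assert (Ht := Rabs_triang (U1 x - U2 x - (c1 - c2)) (c1 - c2)).
replace (U1 x - U2 x - (c1 - c2) + (c1 - c2)) with (U1 x - U2 x) in Ht by ring.
assert (Hc := Rabs_pos (c1 - c2)). assert (Hp := Rabs_pos (p1 - p2)).
assert (Hcp : 0 <= C * Rabs (p1 - p2)) by (apply Rmult_le_pos; lra).
nra.
Qed.

Lemma picard_contraction (b : R -> R) (M L k P D c1 c2 p1 p2 : R)
  (u1 U1 W1 u2 U2 W2 : R -> R) :
  0 < k -> bounded_lipschitz b M L -> Rabs p1 <= P -> 0 <= D ->
  picard_step b k c1 p1 u1 U1 W1 -> picard_step b k c2 p2 u2 U2 W2 ->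
  (forall x, Rabs (u1 x - u2 x) <= D * weight (P * L * gauss M k) (Rabs x)) ->
  forall x, Rabs (U1 x - U2 x) <=
    (Rabs (c1 - c2) + gauss M k * Rabs (p1 - p2) + D / 2) *
    weight (P * L * gauss M k) (Rabs x).
Proof.
intros Hk Hb HP HD H1 H2 Hu x. destruct (Rle_lt_dec 0 x) as [Hx | Hx].
- rewrite (Rabs_pos_eq x) by auto.
  apply (picard_contraction_pos b M L k P D c1 c2 p1 p2 u1 U1 W1 u2 U2 W2); auto.
  intros y Hy. rewrite <- (Rabs_pos_eq y) at 3 by auto. auto.
- rewrite (Rabs_left x) by auto.
  replace (Rabs (p1 - p2)) with (Rabs (- p1 - - p2))
    by (rewrite <- Rabs_Ropp; f_equal; ring).
  replace (U1 x - U2 x) with (U1 (- - x) - U2 (- - x)) by (rewrite Ropp_involutive; auto).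
  apply (picard_contraction_pos (fun y => - b y) M L k P D c1 c2 (- p1) (- p2)
    (fun x => u1 (- x)) (fun x => U1 (- x)) (fun x => W1 (- x))
    (fun x => u2 (- x)) (fun x => U2 (- x)) (fun x => W2 (- x))); auto.
  + apply bounded_lipschitz_opp; auto.
  + rewrite Rabs_Ropp; auto.
  + apply picard_step_reflect; auto.
  + apply picard_step_reflect; auto.
  + intros y Hy. rewrite <- (Rabs_pos_eq y) at 3 by auto.
    rewrite <- (Rabs_Ropp y). auto.
  + lra.
Qed.

Lemma picard_slope_bound (b : R -> R) (M L k c p : R) (u U W : R -> R) (x : R) :
  0 < k -> bounded_lipschitz b M L -> picard_step b k c p u U W -> 0 <= x ->
  Rabs (p * exp (W x)) <= Rabs p * gauss M k * exp (- (2 * x)).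
Proof.
intros Hk Hb Hs Hx. rewrite Rabs_mult, (Rabs_pos_eq (exp _)) by apply Rlt_le, exp_pos.
rewrite Rmult_assoc. apply Rmult_le_compat_l; [apply Rabs_pos|].
apply (exp_exponent_le b M L k c p u U W); auto.
Qed.

Lemma picard_tail (b : R -> R) (M L k c p : R) (u U W : R -> R) (x y : R) :
  0 < k -> bounded_lipschitz b M L -> picard_step b k c p u U W -> 0 <= x <= y ->
  Rabs (U y - U x) <= Rabs p * gauss M k * (exp (- (2 * x)) - exp (- (2 * y))).
Proof.
intros Hk Hb Hs [Hx Hy]. set (K := Rabs p * gauss M k).
assert (HK : 0 <= K) by
  (apply Rmult_le_pos; [apply Rabs_pos | apply Rlt_le, gauss_pos]).
apply Rle_trans with (- (K / 2) * exp (- (2 * y)) - - (K / 2) * exp (- (2 * x))).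
- apply (variation_bound U (fun t => p * exp (W t)) (fun t => - (K / 2) * exp (- (2 * t)))
    (fun t => K * exp (- (2 * t)))); auto.
  + intros t _. apply Hs.
  + intros t _. auto_derive; auto. field.
  + intros t Ht. apply (picard_slope_bound b M L k c p u U W); auto; lra.
- assert (exp (- (2 * y)) <= exp (- (2 * x))) by (apply exp_nondecreasing; lra). nra.
Qed.

Lemma picard_bounded (b : R -> R) (M L k c p : R) (u U W : R -> R) (x : R) :
  0 < k -> bounded_lipschitz b M L -> picard_step b k c p u U W ->
  Rabs (U x - c) <= Rabs p * gauss M k.
Proof.
intros Hk Hb Hs.
assert (Hw : forall b c p u U W x, bounded_lipschitz b M L -> picard_step b k c p u U W ->
  0 <= x -> Rabs (U x - c) <= Rabs p * gauss M k).
{ clear - Hk. intros b c p u U W x Hb Hs Hx.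
  assert (H := picard_tail b M L k c p u U W 0 x Hk Hb Hs (conj (Rle_refl 0) Hx)).
  destruct Hs as (HU & _). rewrite HU in H.
  apply Rle_trans with (1 := H). rewrite Rmult_0_r, Ropp_0, exp_0.
  assert (He := exp_pos (- (2 * x))).
  assert (0 <= Rabs p * gauss M k) by
    (apply Rmult_le_pos; [apply Rabs_pos | apply Rlt_le, gauss_pos]).
  nra. }
destruct (Rle_lt_dec 0 x) as [Hx | Hx].
- apply (Hw b c p u U W x); auto.
- rewrite <- (Rabs_Ropp p). rewrite <- (Ropp_involutive x).
  apply (Hw (fun y => - b y) c (- p) (fun y => u (- y)) (fun y => U (- y)) (fun y => W (- y))
    (- x)); auto.
  + apply bounded_lipschitz_opp; auto.
  + apply picard_step_reflect; auto.
  + lra.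
Qed.

(** The constant is the same for every input [u], so it passes to the limit of the Picard iterates
    and makes that limit continuous. *)
Lemma picard_lipschitz (b : R -> R) (M L k c p : R) (u U W : R -> R) (x y : R) :
  0 < k -> bounded_lipschitz b M L -> picard_step b k c p u U W ->
  Rabs (U x - U y) <= Rabs p * gauss M k * Rabs (x - y).
Proof.
intros Hk Hb Hs. set (K := Rabs p * gauss M k).
assert (HK : 0 <= K) by
  (apply Rmult_le_pos; [apply Rabs_pos | apply Rlt_le, gauss_pos]).
assert (Hd : forall t, Rabs (p * exp (W t)) <= K).
{ assert (Hw : forall b c p u U W t, bounded_lipschitz b M L -> picard_step b k c p u U W ->
    0 <= t -> Rabs (p * exp (W t)) <= Rabs p * gauss M k).
  { clear - Hk. intros b c p u U W t Hb Hs Ht.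
    apply Rle_trans with (1 := picard_slope_bound b M L k c p u U W t Hk Hb Hs Ht).
    assert (0 <= Rabs p * gauss M k) by
      (apply Rmult_le_pos; [apply Rabs_pos | apply Rlt_le, gauss_pos]).
    assert (exp (- (2 * t)) <= 1) by (rewrite <- exp_0; apply exp_nondecreasing; lra). nra. }
  intros t. destruct (Rle_lt_dec 0 t) as [Ht | Ht].
  - apply (Hw b c p u U W); auto.
  - unfold K. rewrite <- (Rabs_Ropp p), <- (Rabs_Ropp (p * _)).
    rewrite <- (Ropp_involutive t). rewrite Ropp_mult_distr_l.
    apply (Hw (fun y => - b y) c (- p) (fun y => u (- y)) (fun y => U (- y))
      (fun y => W (- y)) (- t)); auto.
    + apply bounded_lipschitz_opp; auto.
    + apply picard_step_reflect; auto.
    + lra. }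
assert (Hw : forall x y, x <= y -> Rabs (U y - U x) <= K * Rabs (y - x)).
{ clear x y. intros x y Hxy. rewrite (Rabs_pos_eq (y - x)) by lra.
  replace (K * (y - x)) with (K * y - K * x) by ring.
  apply (variation_bound U (fun t => p * exp (W t)) (fun t => K * t) (fun _ => K)); auto.
  - intros t _. apply Hs.
  - intros t _. auto_derive; auto; ring. }
destruct (Rle_lt_dec x y).
- rewrite Rabs_minus_sym, (Rabs_minus_sym x y). auto.
- apply Hw; lra.
Qed.

(** * Existence of profiles and dependence on the initial data *)

Lemma picard_step_exists (b : R -> R) (M L k c p : R) (u : R -> R) :
  bounded_lipschitz b M L -> (forall x, continuous u x) ->
  {U : R -> R & {W : R -> R | picard_step b k c p u U W}}.
Proof.
intros (_ & _ & _ & Hlip) Hu.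
set (V := fun r => b (u r) - k * r).
assert (HV : forall x, continuous V x).
{ intros x. apply (continuous_minus (V:=R_NormedModule)).
  - apply (continuous_comp u b); auto. apply lipschitz_continuous with L; auto.
  - apply (ex_derive_continuous (fun r => k * r)). auto_derive; auto. }
set (W := fun x => RInt V 0 x).
assert (HW : forall x, is_derive W x (V x)) by (intros x; apply is_derive_primitive; auto).
set (G := fun s => exp (W s)).
assert (HG : forall x, continuous G x).
{ intros x. apply (continuous_comp W exp).
  - apply (ex_derive_continuous W). exists (V x). apply HW.
  - apply (ex_derive_continuous exp). exists (exp (W x)). apply is_derive_exp. }
exists (fun x => c + p * RInt G 0 x), W. split; [|split; [|split]].
- rewrite RInt_point. unfold zero; simpl. ring.
- unfold W. rewrite RInt_point. reflexivity.
- intros x. replace (p * exp (W x)) with (0 + p * G x) by (unfold G; ring).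
  apply (is_derive_plus (V:=R_NormedModule) (fun _ => c)).
  + apply (is_derive_const (V:=R_NormedModule)).
  + apply (is_derive_scal (fun y => RInt G 0 y)). apply is_derive_primitive; auto.
- exact HW.
Qed.

(** Picard iteration from the constant [c]: consecutive iterates differ by [K / 2 ^ n] in the
    weighted norm, hence converge uniformly because the weight is bounded. *)
Lemma profile_exists (b : R -> R) (M L k c p : R) :
  0 < k -> bounded_lipschitz b M L -> exists u W : R -> R, profile b k c p u W.
Proof.
intros Hk Hb.
set (C := gauss M k). set (K := Rabs p * C). set (A := Rabs p * L * C).
assert (HC : 0 < C) by apply gauss_pos.
assert (HL : 0 <= L) by apply Hb.
assert (HK : 0 <= K) by (apply Rmult_le_pos; [apply Rabs_pos | lra]).
assert (HA : 0 <= A) by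
  (apply Rmult_le_pos; [apply Rmult_le_pos; auto; apply Rabs_pos | lra]).
set (Q := exp (2 * A)). assert (HQ : 0 < Q) by apply exp_pos.
(* The operator integrates [b (u s)], so the iteration runs on the subtype of continuous
   functions. *)
assert (next : forall u : {u : R -> R | forall x, continuous u x},
  {U : {u : R -> R | forall x, continuous u x} |
    exists W, picard_step b k c p (proj1_sig u) (proj1_sig U) W}).
{ intros [u Hu]. destruct (picard_step_exists b M L k c p u Hb Hu) as [U [W HUW]].
  assert (HU : forall x, continuous U x).
  { apply lipschitz_continuous with K. intros x y.
    apply (picard_lipschitz b M L k c p u U W); auto. }
  exists (exist _ U HU). exists W. exact HUW. }
assert (Hc : forall x, continuous (fun _ : R => c) x) by (intros x; apply continuous_const).
set (U := fun n => proj1_sig (Nat.iter n (fun u => proj1_sig (next u)) (exist _ _ Hc))).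
assert (HU : forall n, exists W, picard_step b k c p (U n) (U (S n)) W).
{ intros n. exact (proj2_sig (next (Nat.iter n (fun u => proj1_sig (next u)) (exist _ _ Hc)))). }
assert (Hpow : forall n, 0 < 2 ^ n) by (intros n; apply pow_lt; lra).
assert (Hd : forall n x, Rabs (U (S n) x - U n x) <= K / 2 ^ n * weight A (Rabs x)).
{ induction n as [|n IH]; intros x.
  - destruct (HU O) as [W HW].
    assert (H := picard_bounded b M L k c p (U O) (U 1%nat) W x Hk Hb HW).
    change (U O x) with c. simpl pow.
    assert (Hw := weight_ge1 A (Rabs x) HA (Rabs_pos x)). fold C K in H. nra.
  - destruct (HU n) as [W1 H1]. destruct (HU (S n)) as [W2 H2].
    assert (HD : 0 <= K / 2 ^ n) by (apply Rdiv_le_0_compat; auto).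
    assert (H := picard_contraction b M L k (Rabs p) (K / 2 ^ n) c c p p _ _ _ _ _ _
      Hk Hb (Rle_refl _) HD H2 H1 IH x).
    apply Rle_trans with (1 := H). apply Req_le.
    rewrite !Rminus_diag, Rabs_R0. fold C A. simpl. field.
    apply Rgt_not_eq, Hpow. }
assert (Hg : forall x n, Rabs (U (S n) x - U n x) <= (K * Q) / 2 ^ n).
{ intros x n. apply Rle_trans with (1 := Hd n x).
  replace (K * Q / 2 ^ n) with (K / 2 ^ n * Q) by (field; apply Rgt_not_eq, Hpow).
  apply Rmult_le_compat_l; [apply Rdiv_le_0_compat; auto|]. apply weight_le; auto. }
set (u := fun x => proj1_sig (geometric_limit (fun n => U n x) (K * Q) (Hg x))).
assert (Hu : forall x n, Rabs (U n x - u x) <= 2 * (K * Q) / 2 ^ n).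
{ intros x. exact (proj2_sig (geometric_limit (fun n => U n x) (K * Q) (Hg x))). }
assert (Hlip : forall x y, Rabs (u x - u y) <= K * Rabs (x - y)).
{ intros x y. apply le_of_geometric with (2 * (K * Q)). intros n.
  destruct (HU n) as [W HW].
  assert (H := picard_lipschitz b M L k c p _ _ _ x y Hk Hb HW). fold C K in H.
  assert (Hx := Hu x (S n)). assert (Hy := Hu y (S n)).
  replace (2 * (K * Q) / 2 ^ S n) with (2 * (K * Q) / 2 ^ n / 2) in Hx, Hy
    by (simpl; field; apply Rgt_not_eq, Hpow).
  rewrite Rabs_minus_sym in Hx.
  replace (u x - u y) with ((u x - U (S n) x) + (U (S n) x - U (S n) y) + (U (S n) y - u y))
    by ring.
  apply Rle_trans with (1 := Rabs_triang _ _).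
  assert (Ht := Rabs_triang (u x - U (S n) x) (U (S n) x - U (S n) y)). lra. }
(* At this point [u] is only known to be Lipschitz; one more application of the operator gives a
   differentiable [V], which is then shown to equal [u]. *)
destruct (picard_step_exists b M L k c p u Hb) as [V [W HV]].
{ apply lipschitz_continuous with K. exact Hlip. }
assert (Heq : forall x, V x = u x).
{ intros x. apply Rminus_diag_uniq.
  assert (H0 : Rabs (V x - u x) <= 0).
  (* The first summand bounds [V - U (S n)], by contraction from the distance of [u] to [U n]; the
     second bounds [U (S n) - u]. *)
  { apply le_of_geometric with (K * Q * Q + K * Q). intros n.
    destruct (HU n) as [Wn HWn].
    assert (HD : 0 <= 2 * (K * Q) / 2 ^ n)
      by (apply Rdiv_le_0_compat; auto; apply Rmult_le_pos; [lra|]; apply Rmult_le_pos; lra).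
    assert (Hx : Rabs (V x - U (S n) x) <= (K * Q) / 2 ^ n * Q).
    { apply Rle_trans with
        ((Rabs (c - c) + gauss M k * Rabs (p - p) + 2 * (K * Q) / 2 ^ n / 2) *
         weight (Rabs p * L * gauss M k) (Rabs x)).
      - apply (picard_contraction b M L k (Rabs p) (2 * (K * Q) / 2 ^ n) c c p p
          u V W (U n) (U (S n)) Wn); auto using Rle_refl.
        intros y. rewrite Rabs_minus_sym. apply Rle_trans with (1 := Hu y n).
        rewrite <- (Rmult_1_r (2 * (K * Q) / 2 ^ n)) at 1.
        apply Rmult_le_compat_l; auto. apply weight_ge1; auto. apply Rabs_pos.
      - rewrite !Rminus_diag, Rabs_R0. fold C A.
        replace (0 + C * 0 + 2 * (K * Q) / 2 ^ n / 2) with (K * Q / 2 ^ n)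
          by (field; apply Rgt_not_eq, Hpow).
        apply Rmult_le_compat_l; [|apply weight_le; auto].
        apply Rdiv_le_0_compat; auto. apply Rmult_le_pos; lra. }
    assert (Hy := Hu x (S n)).
    replace (2 * (K * Q) / 2 ^ S n) with (K * Q / 2 ^ n) in Hy
      by (simpl; field; apply Rgt_not_eq, Hpow).
    replace (V x - u x) with ((V x - U (S n) x) + (U (S n) x - u x)) by ring.
    apply Rle_trans with (1 := Rabs_triang _ _).
    replace (0 + (K * Q * Q + K * Q) / 2 ^ n) with (K * Q / 2 ^ n * Q + K * Q / 2 ^ n)
      by (field; apply Rgt_not_eq, Hpow).
    lra. }
  destruct (Req_dec (V x - u x) 0) as [|Hne]; auto.
  apply Rabs_pos_lt in Hne. lra. }
exists u, W. destruct HV as (HV0 & HW0 & HdV & HdW).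
split; [|split; [|split]]; auto.
- rewrite <- Heq. exact HV0.
- intros x. apply (is_derive_ext V); auto.
Qed.

(** Both profiles are fixed points, so a weighted bound [D] on their difference improves to
    [d + D / 2]. Iterating from a crude bound leads to the fixed point [2 * d], and the boundedness
    of the weight makes the result uniform on the line. *)
Lemma profile_stability (b : R -> R) (M L k P c1 c2 p1 p2 : R) (u1 W1 u2 W2 : R -> R) (x : R) :
  0 < k -> bounded_lipschitz b M L -> Rabs p1 <= P ->
  profile b k c1 p1 u1 W1 -> profile b k c2 p2 u2 W2 ->
  Rabs (u1 x - u2 x) <=
    2 * (Rabs (c1 - c2) + gauss M k * Rabs (p1 - p2)) * exp (2 * (P * L * gauss M k)).
Proof.
intros Hk Hb HP H1 H2.
set (d := Rabs (c1 - c2) + gauss M k * Rabs (p1 - p2)).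
set (A := P * L * gauss M k).
assert (HC := gauss_pos M k).
assert (Hp1 := Rabs_pos p1). assert (Hp2 := Rabs_pos p2).
assert (HA : 0 <= A).
{ apply Rmult_le_pos; [apply Rmult_le_pos|]; try lra. apply Hb. }
assert (Hd : 0 <= d).
{ apply Rplus_le_le_0_compat; [apply Rabs_pos|].
  apply Rmult_le_pos; [lra | apply Rabs_pos]. }
set (D := Rabs (c1 - c2) + (Rabs p1 + Rabs p2) * gauss M k).
assert (HD : 0 <= D).
{ apply Rplus_le_le_0_compat; [apply Rabs_pos|]. apply Rmult_le_pos; lra. }
assert (Hpow : forall n, 0 < 2 ^ n) by (intros n; apply pow_lt; lra).
assert (Hn : forall n x, Rabs (u1 x - u2 x) <= (2 * d + D / 2 ^ n) * weight A (Rabs x)).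
{ induction n as [|n IH]; intros y.
  - assert (B1 := picard_bounded b M L k c1 p1 u1 u1 W1 y Hk Hb H1).
    assert (B2 := picard_bounded b M L k c2 p2 u2 u2 W2 y Hk Hb H2).
    assert (B : Rabs (u1 y - u2 y) <= D).
    { replace (u1 y - u2 y) with ((u1 y - c1) + (c1 - c2) + - (u2 y - c2)) by ring.
      apply Rle_trans with (1 := Rabs_triang _ _). rewrite Rabs_Ropp.
      assert (Ht := Rabs_triang (u1 y - c1) (c1 - c2)). unfold D. lra. }
    assert (Hw := weight_ge1 A (Rabs y) HA (Rabs_pos y)). simpl. nra.
  - assert (H0 : 0 <= 2 * d + D / 2 ^ n).
    { apply Rplus_le_le_0_compat; [lra|]. apply Rdiv_le_0_compat; auto. }
    assert (H := picard_contraction b M L k P _ c1 c2 p1 p2 _ _ _ _ _ _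
      Hk Hb HP H0 H1 H2 IH y).
    apply Rle_trans with (1 := H). apply Req_le. fold d A. simpl. field.
    apply Rgt_not_eq, Hpow. }
apply le_of_geometric with (D * exp (2 * A)). intros n.
apply Rle_trans with (1 := Hn n x).
replace (2 * d * exp (2 * A) + D * exp (2 * A) / 2 ^ n) with
  ((2 * d + D / 2 ^ n) * exp (2 * A)) by (field; apply Rgt_not_eq, Hpow).
apply Rmult_le_compat_l; [|apply weight_le; auto].
apply Rplus_le_le_0_compat; [lra|]. apply Rdiv_le_0_compat; auto.
Qed.

(** * Limits of profiles at infinity *)

Lemma exp_neg_small (K e : R) :
  0 < e -> exists X, 0 <= X /\ forall x, X <= x -> K * exp (- x) < e.
Proof.
(* Since [1 + x <= exp x], any [x >= Rabs K / e] satisfies [Rabs K < e * exp x]. *)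
intros He. exists (Rabs K / e). split.
- apply Rdiv_le_0_compat; auto. apply Rabs_pos.
- intros x Hx. assert (H := exp_ineq1_le x). assert (Hp := exp_pos (- x)).
  assert (Hx2 : Rabs K < e * exp x).
  { apply Rmult_le_compat_r with (r := e) in Hx; [|lra].
    unfold Rdiv in Hx. rewrite Rmult_assoc, Rinv_l in Hx by lra. nra. }
  apply Rmult_lt_compat_r with (r := exp (- x)) in Hx2; auto.
  rewrite Rmult_assoc, <- exp_plus, Rplus_opp_r, exp_0 in Hx2.
  assert (HK := Rle_abs K). nra.
Qed.

Lemma is_lim_of_exponential_tail (u : R -> R) (K l : R) :
  (forall x, 0 <= x -> Rabs (u x - l) <= K * exp (- (2 * x))) -> is_lim u p_infty l.
Proof.
intros H. apply is_lim_spec. intros e.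
destruct (exp_neg_small K e (cond_pos e)) as [X [HX HK]].
exists X. intros x Hx. apply Rle_lt_trans with (1 := H x ltac:(lra)). apply HK. lra.
Qed.

Lemma is_lim_reflect (u : R -> R) (l : R) :
  is_lim u m_infty l <-> is_lim (fun x => u (- x)) p_infty l.
Proof.
split; intros H; apply is_lim_spec; apply is_lim_spec in H; intros e;
  destruct (H e) as [X HX]; exists (- X); intros x Hx.
- apply HX. lra.
- rewrite <- (Ropp_involutive x). apply HX. lra.
Qed.

Lemma profile_tail_exists (b : R -> R) (M L k c p : R) (u W : R -> R) :
  0 < k -> bounded_lipschitz b M L -> profile b k c p u W ->
  {l : R | forall x, 0 <= x -> Rabs (u x - l) <= Rabs p * gauss M k * exp (- (2 * x))}.
Proof.
intros Hk Hb Hs. set (K := Rabs p * gauss M k).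
assert (HK : 0 <= K) by
  (apply Rmult_le_pos; [apply Rabs_pos | apply Rlt_le, gauss_pos]).
(* By [picard_tail] any two of these intervals meet. Taking [Rabs x] lets all reals index points of
   the half line. *)
destruct (separating_real 0 (fun x => u (Rabs x) - K * exp (- (2 * Rabs x)))
  (fun x => u (Rabs x) + K * exp (- (2 * Rabs x)))) as [l Hl].
- intros i j. assert (Hi := Rabs_pos i). assert (Hj := Rabs_pos j).
  assert (Ei := exp_pos (- (2 * Rabs i))). assert (Ej := exp_pos (- (2 * Rabs j))).
  destruct (Rle_lt_dec (Rabs i) (Rabs j)) as [Hij | Hij].
  + assert (H := picard_tail b M L k c p u u W _ _ Hk Hb Hs (conj Hi Hij)).
    fold K in H. apply Rabs_le_between in H. nra.
  + assert (H := picard_tail b M L k c p u u W _ _ Hk Hb Hs (conj Hj (Rlt_le _ _ Hij))).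
    fold K in H. apply Rabs_le_between in H. nra.
- exists l. intros x Hx. specialize (Hl x). rewrite (Rabs_pos_eq x) in Hl by auto.
  apply Rabs_le_between. lra.
Qed.

Lemma profile_tail (b : R -> R) (M L k c p l : R) (u W : R -> R) :
  0 < k -> bounded_lipschitz b M L -> profile b k c p u W -> is_lim u p_infty l ->
  forall x, 0 <= x -> Rabs (u x - l) <= Rabs p * gauss M k * exp (- (2 * x)).
Proof.
intros Hk Hb Hs Hl.
destruct (profile_tail_exists b M L k c p u W Hk Hb Hs) as [l' Hl'].
assert (H := is_lim_of_exponential_tail u _ l' Hl').
apply is_lim_unique in H. apply is_lim_unique in Hl. rewrite H in Hl.
injection Hl as ->. exact Hl'.
Qed.

(** * The flux, its maximum principle and uniqueness *)

Lemma derive_pos_local (h : R -> R) (x l : R) :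
  is_derive h x l -> 0 < l ->
  exists d, 0 < d /\ forall t, 0 < t < d -> h (x - t) < h x < h (x + t).
Proof.
intros Hd Hl. apply is_derive_Reals in Hd.
destruct (Hd l Hl) as [d Hdelta]. exists d. split; [apply cond_pos|].
assert (Hpos : forall s, s <> 0 -> Rabs s < d -> 0 < (h (x + s) - h x) / s).
{ intros s Hs0 Hs. specialize (Hdelta s Hs0 Hs). apply Rabs_lt_between in Hdelta. lra. }
intros t Ht. split.
- specialize (Hpos (- t) ltac:(lra)). rewrite Rabs_Ropp, Rabs_pos_eq in Hpos by lra.
  specialize (Hpos ltac:(lra)).
  assert (H : h (x + - t) - h x = (h (x + - t) - h x) / - t * - t) by (field; lra).
  unfold Rminus at 1. nra.
- specialize (Hpos t ltac:(lra)). rewrite Rabs_pos_eq in Hpos by lra.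
  specialize (Hpos ltac:(lra)).
  assert (H : h (x + t) - h x = (h (x + t) - h x) / t * t) by (field; lra). nra.
Qed.

(* A maximum of [J] on an interval with value at least [J x0] would force [w = 0] and
   [w' = J > 0] there, so [J] would still increase to its right. *)
Lemma energy_maximum_principle (k : R) (J w dw : R -> R) (x0 x : R) :
  0 < k -> (forall y, is_derive J y (k * w y)) -> (forall y, is_derive w y (dw y)) ->
  (forall y, w y = 0 -> J y = dw y) -> 0 <= w x0 -> 0 < J x0 -> x0 <= x -> J x0 <= J x.
Proof.
intros Hk HJ Hw H0 Hw0 HJ0 Hx. apply Rnot_lt_le. intros Hlt.
destruct (continuity_ab_maj J x0 x Hx) as [y [Hmax Hy]].
{ intros z _. apply continuity_pt_filterlim, (ex_derive_continuous J z).
  eexists. apply HJ. }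
assert (Hy0 := Hmax x0 (conj (Rle_refl _) Hx)).
assert (Hyx : y < x).
{ destruct (Req_dec y x) as [->|]; lra. }
(* If [w y > 0], then [J] exceeds its maximum just to the right of [y]; if [w y < 0], just to the
   left, where there is room because [0 <= w x0] excludes [y = x0]. *)
assert (Hwy : w y = 0).
{ apply Rle_antisym; apply Rnot_lt_le; intros Hwy.
  - destruct (derive_pos_local J y _ (HJ y)) as [d [Hd Hinc]]; [nra|].
    set (t := Rmin (d / 2) (x - y)).
    assert (Ht : 0 < t < d /\ t <= x - y).
    { unfold t. assert (H1 := Rmin_l (d / 2) (x - y)). assert (H2 := Rmin_r (d / 2) (x - y)).
      split; auto. split; [apply Rmin_glb_lt|]; lra. }
    specialize (Hinc t (proj1 Ht)). specialize (Hmax (y + t) ltac:(lra)). lra.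
  - destruct (Req_dec y x0) as [->|Hne]; [lra|].
    destruct (derive_pos_local (fun z => - J z) y (- (k * w y))) as [d [Hd Hinc]].
    + apply (is_derive_opp (V:=R_NormedModule)), HJ.
    + nra.
    + set (t := Rmin (d / 2) (y - x0)).
      assert (Ht : 0 < t < d /\ t <= y - x0).
      { unfold t. assert (H1 := Rmin_l (d / 2) (y - x0)).
        assert (H2 := Rmin_r (d / 2) (y - x0)).
        split; auto. split; [apply Rmin_glb_lt|]; lra. }
      specialize (Hinc t (proj1 Ht)). specialize (Hmax (y - t) ltac:(lra)). lra. }
assert (Hdw : 0 < dw y) by (rewrite <- H0; auto; lra).
destruct (derive_pos_local w y _ (Hw y) Hdw) as [d [Hd Hinc]].
set (t := Rmin (d / 2) (x - y)).
assert (Ht : 0 < t < d /\ t <= x - y).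
{ unfold t. assert (H1 := Rmin_l (d / 2) (x - y)). assert (H2 := Rmin_r (d / 2) (x - y)).
  split; auto. split; [apply Rmin_glb_lt|]; lra. }
assert (Hwpos : forall z, y <= z <= y + t -> 0 <= w z).
{ intros z Hz. destruct (Req_dec z y) as [->|]; [lra|].
  specialize (Hinc (z - y) ltac:(lra)). replace (y + (z - y)) with z in Hinc by ring. lra. }
assert (Hmid : J y <= J (y + t / 2)).
{ apply (nondecreasing_of_derive J (fun z => k * w z)); auto; [lra|].
  intros z Hz. specialize (Hwpos z ltac:(lra)). nra. }
(* So far [J] is only known not to drop on [[y, y + t / 2]]; at the right end [w] is strictly
   positive, so a little further [J] exceeds the maximum. *)
destruct (derive_pos_local J (y + t / 2) _ (HJ _)) as [d' [Hd' Hinc']].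
{ specialize (Hinc (t / 2) ltac:(lra)). nra. }
set (s := Rmin (d' / 2) (t / 2)).
assert (Hs : 0 < s < d' /\ s <= t / 2).
{ unfold s. assert (H1 := Rmin_l (d' / 2) (t / 2)). assert (H2 := Rmin_r (d' / 2) (t / 2)).
  split; auto. split; [apply Rmin_glb_lt|]; lra. }
specialize (Hinc' s (proj1 Hs)). specialize (Hmax (y + t / 2 + s) ltac:(lra)). lra.
Qed.

(* With [B' = b] the equation is [(u' - B u + k x u)' = k u]; this is the bracket
   for [u1] minus the one for [u2]. *)
Definition flux (B : R -> R) (k p1 : R) (u1 W1 : R -> R) (p2 : R) (u2 W2 : R -> R) (x : R) : R :=
  p1 * exp (W1 x) - p2 * exp (W2 x) - (B (u1 x) - B (u2 x)) + k * x * (u1 x - u2 x).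

Lemma is_derive_flux (B b : R -> R) (k c1 p1 c2 p2 : R) (u1 W1 u2 W2 : R -> R) (x : R) :
  (forall y, is_derive B y (b y)) ->
  profile b k c1 p1 u1 W1 -> profile b k c2 p2 u2 W2 ->
  is_derive (flux B k p1 u1 W1 p2 u2 W2) x (k * (u1 x - u2 x)).
Proof.
intros HB (_ & _ & Hu1 & HW1) (_ & _ & Hu2 & HW2).
unfold flux. auto_derive.
- repeat match goal with
  | |- _ /\ _ => split
  | |- True => exact I
  | |- ex_derive (fun y => B y) _ => exact (ex_intro _ _ (HB _))
  | |- ex_derive (fun y => W1 y) _ => exact (ex_intro _ _ (HW1 _))
  | |- ex_derive (fun y => W2 y) _ => exact (ex_intro _ _ (HW2 _))
  | |- ex_derive (fun y => u1 y) _ => exact (ex_intro _ _ (Hu1 _))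
  | |- ex_derive (fun y => u2 y) _ => exact (ex_intro _ _ (Hu2 _))
  end.
- change (fun y => B y) with B. change (fun y => W1 y) with W1.
  change (fun y => W2 y) with W2. change (fun y => u1 y) with u1.
  change (fun y => u2 y) with u2.
  rewrite (is_derive_unique B _ _ (HB (u1 x))), (is_derive_unique B _ _ (HB (u2 x))),
    (is_derive_unique W1 _ _ (HW1 x)), (is_derive_unique W2 _ _ (HW2 x)),
    (is_derive_unique u1 _ _ (Hu1 x)), (is_derive_unique u2 _ _ (Hu2 x)).
  ring.
Qed.

(** Up to exponentially small terms the flux is at most [(M - k * x) * (l2 - l1)], which is
    nonpositive as soon as [M <= k * x]. *)
Lemma flux_eventually_small (B b : R -> R) (M L k c1 p1 c2 p2 l1 l2 e X : R)
  (u1 W1 u2 W2 : R -> R) :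
  0 < k -> bounded_lipschitz b M L -> (forall y, is_derive B y (b y)) ->
  profile b k c1 p1 u1 W1 -> profile b k c2 p2 u2 W2 ->
  is_lim u1 p_infty l1 -> is_lim u2 p_infty l2 -> l1 <= l2 -> 0 < e ->
  exists x, X <= x /\ flux B k p1 u1 W1 p2 u2 W2 x < e.
Proof.
intros Hk Hb HB H1 H2 Hl1 Hl2 Hl He.
set (K := (Rabs p1 + Rabs p2) * gauss M k).
assert (HM : 0 <= M) by apply Hb.
destruct (exp_neg_small (K * (1 + M + k)) e He) as [Y [HY0 HY]].
(* [Y] makes the exponential errors smaller than [e], and [M / k] lets the linear term dominate the
   difference of the [B] terms. *)
set (x := Rmax (Rmax X Y) (M / k)).
assert (Hx : X <= x /\ Y <= x /\ M / k <= x).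
{ unfold x. assert (A1 := Rmax_l (Rmax X Y) (M / k)). assert (A2 := Rmax_r (Rmax X Y) (M / k)).
  assert (A3 := Rmax_l X Y). assert (A4 := Rmax_r X Y). lra. }
exists x. split; [lra|].
assert (Hx0 : 0 <= x) by lra.
assert (T1 := profile_tail _ _ _ _ _ _ _ _ _ Hk Hb H1 Hl1 x Hx0).
assert (T2 := profile_tail _ _ _ _ _ _ _ _ _ Hk Hb H2 Hl2 x Hx0).
assert (S1 := picard_slope_bound _ _ _ _ _ _ _ _ _ x Hk Hb H1 Hx0).
assert (S2 := picard_slope_bound _ _ _ _ _ _ _ _ _ x Hk Hb H2 Hx0).
apply Rabs_le_between in T1, T2, S1, S2.
set (E := exp (- (2 * x))) in *.
assert (HE : 0 < E) by apply exp_pos.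
assert (HK : 0 <= K * E).
{ unfold K. assert (A1 := Rabs_pos p1). assert (A2 := Rabs_pos p2).
  assert (A3 := gauss_pos M k). apply Rmult_le_pos; [|lra]. apply Rmult_le_pos; lra. }
assert (HKE : K * E = Rabs p1 * gauss M k * E + Rabs p2 * gauss M k * E)
  by (unfold K; ring).
assert (Hw : u1 x - u2 x <= l1 - l2 + K * E) by lra.
assert (Hw' : Rabs (u1 x - u2 x) <= l2 - l1 + K * E) by (apply Rabs_le_between; lra).
assert (HBl : Rabs (B (u1 x) - B (u2 x)) <= M * Rabs (u1 x - u2 x)).
{ assert (HBw : forall y z, y <= z -> Rabs (B z - B y) <= M * Rabs (z - y)).
  { intros y z Hyz. rewrite (Rabs_pos_eq (z - y)) by lra.
    replace (M * (z - y)) with (M * z - M * y) by ring.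
    apply (variation_bound B b (fun t => M * t) (fun _ => M)); auto.
    - intros t _. auto_derive; auto; ring.
    - intros t _. apply Hb. }
  destruct (Rle_lt_dec (u1 x) (u2 x)).
  - rewrite Rabs_minus_sym, (Rabs_minus_sym (u1 x)). auto.
  - apply HBw; lra. }
apply Rabs_le_between in HBl.
assert (Hkx : M <= k * x).
{ destruct Hx as (_ & _ & Hx). apply Rmult_le_compat_l with (r := k) in Hx; [|lra].
  replace (k * (M / k)) with M in Hx by (field; lra). exact Hx. }
apply Rle_lt_trans with (K * (1 + M + k) * exp (- x)); [|apply HY; lra].
assert (HxE : x * E <= exp (- x)) by apply mul_exp_neg_le.
assert (HEx : E <= exp (- x)) by (apply exp_nondecreasing; lra).
assert (HKp : 0 <= K) by nra.
apply Rle_trans with (K * E * (1 + M) + k * K * (x * E)).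
- unfold flux.
  assert (Q1 : M * Rabs (u1 x - u2 x) <= M * (l2 - l1 + K * E))
    by (apply Rmult_le_compat_l; lra).
  assert (Q2 : k * x * (u1 x - u2 x) <= k * x * (l1 - l2 + K * E))
    by (apply Rmult_le_compat_l; lra).
  assert (Q3 : 0 <= (k * x - M) * (l2 - l1)) by (apply Rmult_le_pos; lra).
  nra.
- assert (Q1 : K * (1 + M) * E <= K * (1 + M) * exp (- x)).
  { apply Rmult_le_compat_l; auto. apply Rmult_le_pos; lra. }
  assert (Q2 : k * K * (x * E) <= k * K * exp (- x)).
  { apply Rmult_le_compat_l; auto. apply Rmult_le_pos; lra. }
  nra.
Qed.

(** By the maximum principle a positive value at [x] would persist as a lower bound on the whole
    right half line, but the flux later falls below that very value. *)
Lemma flux_nonpos (B b : R -> R) (M L k c1 p1 c2 p2 l1 l2 x : R) (u1 W1 u2 W2 : R -> R) :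
  0 < k -> bounded_lipschitz b M L -> (forall y, is_derive B y (b y)) ->
  profile b k c1 p1 u1 W1 -> profile b k c2 p2 u2 W2 ->
  is_lim u1 p_infty l1 -> is_lim u2 p_infty l2 -> l1 <= l2 -> u2 x <= u1 x ->
  flux B k p1 u1 W1 p2 u2 W2 x <= 0.
Proof.
intros Hk Hb HB H1 H2 Hl1 Hl2 Hl Hx. apply Rnot_lt_le. intros Hpos.
destruct (flux_eventually_small B b M L k c1 p1 c2 p2 l1 l2 _ x u1 W1 u2 W2
  Hk Hb HB H1 H2 Hl1 Hl2 Hl Hpos) as [y [Hy Hlt]].
assert (H : flux B k p1 u1 W1 p2 u2 W2 x <= flux B k p1 u1 W1 p2 u2 W2 y); [|lra].
apply (energy_maximum_principle k _ (fun y => u1 y - u2 y)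
  (fun y => p1 * exp (W1 y) - p2 * exp (W2 y))); auto; [| | |lra].
- intros z. apply (is_derive_flux B b k c1 p1 c2 p2); auto.
- intros z. apply (is_derive_minus (V:=R_NormedModule)); [apply H1 | apply H2].
- intros z Hz. unfold flux. replace (u2 z) with (u1 z) by lra. ring.
Qed.

Lemma primitive_exists (b : R -> R) (M L : R) :
  bounded_lipschitz b M L -> exists B : R -> R, forall y, is_derive B y (b y).
Proof.
intros (_ & _ & _ & Hlip). exists (fun y => RInt b 0 y). intros y.
apply is_derive_primitive. apply lipschitz_continuous with L; auto.
Qed.

(** At 0 the profiles coincide and the flux reduces to [p2 - p1 > 0], which [flux_nonpos] forbids if
    [l2 <= l1]. *)
Lemma profile_limit_strict_mono (b : R -> R) (M L k c p1 p2 l1 l2 : R) (u1 W1 u2 W2 : R -> R) :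
  0 < k -> bounded_lipschitz b M L ->
  profile b k c p1 u1 W1 -> profile b k c p2 u2 W2 ->
  is_lim u1 p_infty l1 -> is_lim u2 p_infty l2 -> p1 < p2 -> l1 < l2.
Proof.
intros Hk Hb H1 H2 Hl1 Hl2 Hp. apply Rnot_le_lt. intros Hl.
destruct (primitive_exists b M L Hb) as [B HB].
assert (H := flux_nonpos B b M L k c p2 c p1 l2 l1 0 u2 W2 u1 W1 Hk Hb HB H2 H1 Hl2 Hl1 Hl).
destruct H1 as (Hu1 & HW1 & _). destruct H2 as (Hu2 & HW2 & _).
unfold flux in H. rewrite Hu1, Hu2, HW1, HW2, exp_0 in H.
specialize (H (Rle_refl c)). lra.
Qed.

(** Reflection alone changes the sign of the flux; exchanging the two profiles restores it. Thus
    [flux_nonpos] can be used towards -oo at points where [u1 < u2]. *)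
Lemma flux_reflect (B : R -> R) (k p1 p2 x : R) (u1 W1 u2 W2 : R -> R) :
  flux (fun y => - B y) k (- p2) (fun y => u2 (- y)) (fun y => W2 (- y))
    (- p1) (fun y => u1 (- y)) (fun y => W1 (- y)) (- x) = flux B k p1 u1 W1 p2 u2 W2 x.
Proof. unfold flux. rewrite Ropp_involutive. ring. Qed.

(** Where [u2 <= u1] the right half line gives a nonpositive flux, elsewhere the left one does.
    Exchanging the profiles shows that the flux vanishes identically, and so does its derivative
    [k * (u1 - u2)]. *)
Lemma profile_bvp_unique (b : R -> R) (M L k c1 p1 c2 p2 lm lp : R) (u1 W1 u2 W2 : R -> R) :
  0 < k -> bounded_lipschitz b M L ->
  profile b k c1 p1 u1 W1 -> profile b k c2 p2 u2 W2 ->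
  is_lim u1 m_infty lm -> is_lim u2 m_infty lm ->
  is_lim u1 p_infty lp -> is_lim u2 p_infty lp -> forall x, u1 x = u2 x.
Proof.
intros Hk Hb H1 H2 Hm1 Hm2 Hp1 Hp2.
destruct (primitive_exists b M L Hb) as [B HB].
assert (Hle : forall c1 p1 c2 p2 u1 W1 u2 W2 x,
  profile b k c1 p1 u1 W1 -> profile b k c2 p2 u2 W2 ->
  is_lim u1 m_infty lm -> is_lim u2 m_infty lm ->
  is_lim u1 p_infty lp -> is_lim u2 p_infty lp -> flux B k p1 u1 W1 p2 u2 W2 x <= 0).
{ clear - Hk Hb HB. intros c1 p1 c2 p2 u1 W1 u2 W2 x H1 H2 Hm1 Hm2 Hp1 Hp2.
  destruct (Rle_lt_dec (u2 x) (u1 x)) as [Hx | Hx].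
  - apply (flux_nonpos B b M L k c1 p1 c2 p2 lp lp); auto using Rle_refl.
  - rewrite <- flux_reflect.
    apply (flux_nonpos (fun y => - B y) (fun y => - b y) M L k c2 (- p2) c1 (- p1) lm lm);
      auto using Rle_refl.
    + apply bounded_lipschitz_opp; auto.
    + intros y. apply (is_derive_opp (V:=R_NormedModule)), HB.
    + apply picard_step_reflect; auto.
    + apply picard_step_reflect; auto.
    + apply is_lim_reflect; auto.
    + apply is_lim_reflect; auto.
    + rewrite Ropp_involutive; lra. }
assert (Hzero : forall x, flux B k p1 u1 W1 p2 u2 W2 x = 0).
{ intros x. assert (A1 := Hle c1 p1 c2 p2 u1 W1 u2 W2 x H1 H2 Hm1 Hm2 Hp1 Hp2).
  assert (A2 := Hle c2 p2 c1 p1 u2 W2 u1 W1 x H2 H1 Hm2 Hm1 Hp2 Hp1).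
  unfold flux in *. lra. }
intros x.
assert (Hd := is_derive_flux B b k c1 p1 c2 p2 u1 W1 u2 W2 x HB H1 H2).
apply (is_derive_ext _ (fun _ => 0)) in Hd; [|exact Hzero].
apply is_derive_unique in Hd. rewrite Derive_const in Hd. nra.
Qed.

(** * Monotone profiles and the shooting argument *)

Lemma lim_dist_le (u1 u2 : R -> R) (x : Rbar) (l1 l2 D : R) :
  (forall y, Rabs (u1 y - u2 y) <= D) -> is_lim u1 x l1 -> is_lim u2 x l2 ->
  Rabs (l1 - l2) <= D.
Proof.
intros HD H1 H2.
assert (H := is_lim_minus' _ _ _ _ _ H1 H2).
apply Rabs_le_between. split.
- apply (is_lim_le_loc (fun _ => - D) (fun y => u1 y - u2 y) x (- D) (l1 - l2)); auto.
  + apply filter_forall. intros y. specialize (HD y). apply Rabs_le_between in HD. lra.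
  + apply is_lim_const.
- apply (is_lim_le_loc (fun y => u1 y - u2 y) (fun _ => D) x (l1 - l2) D); auto.
  + apply filter_forall. intros y. specialize (HD y). apply Rabs_le_between in HD. lra.
  + apply is_lim_const.
Qed.

Lemma exp_slope_nondecreasing (u W : R -> R) (p x y : R) :
  0 <= p -> (forall z, is_derive u z (p * exp (W z))) -> x <= y -> u x <= u y.
Proof.
intros Hp Hd Hxy. apply (nondecreasing_of_derive u (fun z => p * exp (W z))); auto.
intros z _. assert (H := exp_pos (W z)). nra.
Qed.

Lemma exp_slope_limits_pos (u W : R -> R) (p a b x : R) :
  0 <= p -> (forall z, is_derive u z (p * exp (W z))) ->
  is_lim u m_infty a -> is_lim u p_infty b -> a <= u x <= b.
Proof.
intros Hp Hd Ha Hb. split.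
- apply (is_lim_le_loc u (fun _ => u x) m_infty a (u x)); auto; [|apply is_lim_const].
  exists x. intros y Hy. apply (exp_slope_nondecreasing u W p); auto; lra.
- apply (is_lim_le_loc (fun _ => u x) u p_infty (u x) b); auto; [|apply is_lim_const].
  exists x. intros y Hy. apply (exp_slope_nondecreasing u W p); auto; lra.
Qed.

Lemma is_derive_exp_slope_opp (u W : R -> R) (p : R) :
  (forall z, is_derive u z (p * exp (W z))) ->
  forall z, is_derive (fun y => - u y) z (- p * exp (W z)).
Proof.
intros Hd z. replace (- p * exp (W z)) with (- (p * exp (W z))) by ring.
apply (is_derive_opp (V:=R_NormedModule)), Hd.
Qed.

Lemma exp_slope_limits_neg (u W : R -> R) (p a b x : R) :
  p <= 0 -> (forall z, is_derive u z (p * exp (W z))) ->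
  is_lim u m_infty a -> is_lim u p_infty b -> b <= u x <= a.
Proof.
intros Hp Hd Ha Hb.
assert (H : - a <= - u x <= - b); [|lra].
apply (exp_slope_limits_pos (fun y => - u y) W (- p)).
- lra.
- apply is_derive_exp_slope_opp, Hd.
- apply (is_lim_opp u m_infty a), Ha.
- apply (is_lim_opp u p_infty b), Hb.
Qed.

(** The slope has constant sign, so [u] is monotone between its limits. The hypothesis fits the
    clamped and the original equation alike, so the lemma justifies clamping in both directions. *)
Lemma exp_slope_limits (u W : R -> R) (p a b x : R) :
  (forall z, is_derive u z (p * exp (W z))) ->
  is_lim u m_infty a -> is_lim u p_infty b -> Rmin a b <= u x <= Rmax a b.
Proof.
intros Hd Ha Hb.
assert (H1 := Rmin_l a b). assert (H2 := Rmin_r a b).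
assert (H3 := Rmax_l a b). assert (H4 := Rmax_r a b).
destruct (Rle_lt_dec 0 p) as [Hp | Hp].
- assert (H := exp_slope_limits_pos u W p a b x Hp Hd Ha Hb). lra.
- assert (H := exp_slope_limits_neg u W p a b x (Rlt_le _ _ Hp) Hd Ha Hb). lra.
Qed.

(** The rise [kap * p] is already gained on [[0, 1]] and is never lost again. This coercivity in [p]
    makes every right limit attainable. *)
Lemma exp_slope_growth (u W : R -> R) (p kap l : R) :
  0 <= p -> (forall z, is_derive u z (p * exp (W z))) ->
  (forall z, 0 <= z <= 1 -> kap <= exp (W z)) ->
  is_lim u p_infty l -> u 0 + kap * p <= l.
Proof.
intros Hp Hd Hk Hl. apply Rle_trans with (u 1).
- assert (H : u 0 - kap * p * 0 <= u 1 - kap * p * 1); [|lra].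
  apply (nondecreasing_of_derive (fun z => u z - kap * p * z)
    (fun z => p * exp (W z) - kap * p)); [lra| |].
  + intros z _. apply (is_derive_minus (V:=R_NormedModule)); auto.
    auto_derive; auto; ring.
  + intros z Hz. specialize (Hk z Hz). nra.
- apply (is_lim_le_loc (fun _ => u 1) u p_infty (u 1) l); auto; [|apply is_lim_const].
  exists 1. intros y Hy. apply (exp_slope_nondecreasing u W p); auto; lra.
Qed.

Lemma profile_exponent_lower (b : R -> R) (M L k c p : R) (u W : R -> R) (z : R) :
  0 < k -> bounded_lipschitz b M L -> profile b k c p u W -> 0 <= z <= 1 ->
  exp (- M - k / 2) <= exp (W z).
Proof.
intros Hk Hb Hs Hz. apply exp_nondecreasing.
assert (H := exponent_bound b M L k c p u u W z Hb Hs (proj1 Hz)).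
apply Rabs_le_between in H. assert (HM : 0 <= M) by apply Hb.
assert (z ^ 2 <= 1) by nra. nra.
Qed.

(* Solving [Phi c p = uR] for [p = q c] leaves the scalar equation [Psi c (q c) = uL]. *)
Lemma shooting (Phi Psi : R -> R -> R) (kap uL uR : R) :
  0 < kap ->
  (forall P, exists K, forall c1 c2 p1 p2, Rabs p1 <= P ->
    Rabs (Phi c1 p1 - Phi c2 p2) <= K * (Rabs (c1 - c2) + Rabs (p1 - p2))) ->
  (forall P, exists K, forall c1 c2 p1 p2, Rabs p1 <= P ->
    Rabs (Psi c1 p1 - Psi c2 p2) <= K * (Rabs (c1 - c2) + Rabs (p1 - p2))) ->
  (forall c p1 p2, p1 < p2 -> Phi c p1 < Phi c p2) ->
  (forall c p, 0 <= p -> c + kap * p <= Phi c p) ->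
  (forall c p, p <= 0 -> Phi c p <= c + kap * p) ->
  (forall c p, 0 <= p -> Psi c p <= c) ->
  (forall c p, p <= 0 -> c <= Psi c p) ->
  exists c p, Phi c p = uR /\ Psi c p = uL.
Proof.
intros Hkap HPhi HPsi Hmono Hg1 Hg2 Hs1 Hs2.
assert (joint : forall F : R -> R -> R,
  (forall P, exists K, forall c1 c2 p1 p2, Rabs p1 <= P ->
    Rabs (F c1 p1 - F c2 p2) <= K * (Rabs (c1 - c2) + Rabs (p1 - p2))) ->
  forall c0 p0 e, 0 < e -> exists d, 0 < d /\ forall c p,
    Rabs (c - c0) < d -> Rabs (p - p0) < d -> Rabs (F c p - F c0 p0) < e).
{ clear. intros F HF c0 p0 e He. destruct (HF (Rabs p0)) as [K HK].
  assert (HK0 := Rabs_pos K). assert (HK1 := Rle_abs K).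
  exists (e / (2 * (Rabs K + 1))). split; [apply Rdiv_lt_0_compat; lra|].
  intros c p Hc Hp. rewrite Rabs_minus_sym.
  apply Rle_lt_trans with (1 := HK c0 c p0 p (Rle_refl _)).
  rewrite (Rabs_minus_sym c0), (Rabs_minus_sym p0).
  assert (A1 := Rabs_pos (c - c0)). assert (A2 := Rabs_pos (p - p0)).
  apply Rle_lt_trans with ((Rabs K + 1) * (Rabs (c - c0) + Rabs (p - p0))).
  - apply Rmult_le_compat_r; lra.
  - replace e with ((Rabs K + 1) * (2 * (e / (2 * (Rabs K + 1))))) at 1 by (field; lra).
    apply Rmult_lt_compat_l; lra. }
assert (HexP : forall c, {p | Phi c p = uR}).
{ intros c. set (X := Rabs (uR - c) / kap).
  assert (HX : 0 <= X) by (apply Rdiv_le_0_compat; auto; apply Rabs_pos).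
  assert (HkX : kap * X = Rabs (uR - c)) by (unfold X; field; lra).
  assert (A1 := Hg1 c X HX). assert (A2 := Hg2 c (- X) ltac:(lra)).
  assert (A3 := Rle_abs (uR - c)). assert (A4 := Rle_abs (- (uR - c))).
  rewrite Rabs_Ropp in A4.
  destruct (IVT_gen (Phi c) (- X) X uR) as [p [_ Hp]].
  - intros p0 e He. destruct (joint Phi HPhi c p0 e He) as [d [Hd Hj]].
    exists d. split; auto. simpl. unfold R_dist. intros p [_ Hp].
    apply Hj; auto. rewrite Rminus_diag, Rabs_R0; auto.
  - assert (B1 := Rmin_l (Phi c (- X)) (Phi c X)).
    assert (B2 := Rmax_r (Phi c (- X)) (Phi c X)). lra.
  - exists p. exact Hp. }
set (q := fun c => proj1_sig (HexP c)).
assert (Hq : forall c, Phi c (q c) = uR) by (intros c; exact (proj2_sig (HexP c))).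
(* By strict monotonicity the values at [q c0 - e] and [q c0 + e] lie strictly on either side of
   [uR]; they stay there for [c] near [c0], which traps [q c] between these slopes. *)
assert (Hqc : forall c0 e, 0 < e -> exists d, 0 < d /\ forall c,
  Rabs (c - c0) < d -> Rabs (q c - q c0) < e).
{ intros c0 e He.
  assert (B1 := Hmono c0 (q c0 - e) (q c0) ltac:(lra)).
  assert (B2 := Hmono c0 (q c0) (q c0 + e) ltac:(lra)). rewrite Hq in B1, B2.
  destruct (joint Phi HPhi c0 (q c0 - e) (uR - Phi c0 (q c0 - e))) as [d1 [Hd1 J1]]; [lra|].
  destruct (joint Phi HPhi c0 (q c0 + e) (Phi c0 (q c0 + e) - uR)) as [d2 [Hd2 J2]]; [lra|].
  exists (Rmin d1 d2). split; [apply Rmin_glb_lt; auto|]. intros c Hc.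
  assert (M1 := Rmin_l d1 d2). assert (M2 := Rmin_r d1 d2).
  assert (E1 := J1 c (q c0 - e) ltac:(lra) ltac:(rewrite Rminus_diag, Rabs_R0; lra)).
  assert (E2 := J2 c (q c0 + e) ltac:(lra) ltac:(rewrite Rminus_diag, Rabs_R0; lra)).
  apply Rabs_lt_between in E1. apply Rabs_lt_between in E2.
  assert (Hqq := Hq c).
  apply Rabs_lt_between. split; apply Rnot_le_lt; intros Hle.
  - destruct Hle as [Hlt | Heq].
    + assert (H := Hmono c (q c) (q c0 - e) ltac:(lra)). lra.
    + replace (q c) with (q c0 - e) in Hqq by lra. lra.
  - destruct Hle as [Hlt | Heq].
    + assert (H := Hmono c (q c0 + e) (q c) ltac:(lra)). lra.
    + replace (q c) with (q c0 + e) in Hqq by lra. lra. }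
(* The endpoint [c = uR] corresponds to the constant profile, whose left limit is [uR] as well. *)
assert (HqR : q uR = 0).
{ assert (Hqq := Hq uR). apply Rle_antisym; apply Rnot_lt_le; intros H.
  - assert (A := Hg1 uR (q uR) ltac:(lra)). nra.
  - assert (A := Hg2 uR (q uR) ltac:(lra)). nra. }
assert (HR : Psi uR (q uR) = uR).
{ rewrite HqR. apply Rle_antisym; [apply Hs1 | apply Hs2]; lra. }
destruct (IVT_gen (fun c => Psi c (q c)) uL uR uL) as [c [_ Hc]].
- intros c0 e He. destruct (joint Psi HPsi c0 (q c0) e He) as [d [Hd J]].
  destruct (Hqc c0 d Hd) as [d' [Hd' Hj']].
  exists (Rmin d d'). split; [apply Rmin_glb_lt; auto|].
  simpl. unfold R_dist. intros c [_ Hc].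
  assert (M1 := Rmin_l d d'). assert (M2 := Rmin_r d d').
  apply J; [lra|]. apply Hj'. lra.
(* At the endpoint [c = uL] the slope has the sign of [uR - uL], so the left limit lies on the side
   of [uL] away from [uR], and [uL] is an intermediate value. *)
- rewrite HR. assert (Hqq := Hq uL).
  destruct (Rle_lt_dec uL uR) as [H | H].
  + assert (Hp : 0 <= q uL).
    { apply Rnot_lt_le. intros Hn. assert (A := Hg2 uL (q uL) ltac:(lra)). nra. }
    assert (A := Hs1 uL (q uL) Hp). rewrite Rmin_left, Rmax_right; lra.
  + assert (Hp : q uL <= 0).
    { apply Rnot_lt_le. intros Hn. assert (A := Hg1 uL (q uL) ltac:(lra)). nra. }
    assert (A := Hs2 uL (q uL) Hp). rewrite Rmin_right, Rmax_left; lra.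
- exists c, (q c). auto.
Qed.

(** Profile, exponent and both limits are packed into one tuple, so that a single choice turns them
    into functions of [(c, p)]. *)
Lemma profile_limits_exist (b : R -> R) (M L k c p : R) :
  0 < k -> bounded_lipschitz b M L ->
  exists s : (R -> R) * (R -> R) * (R * R),
    profile b k c p (fst (fst s)) (snd (fst s)) /\
    is_lim (fst (fst s)) p_infty (fst (snd s)) /\ is_lim (fst (fst s)) m_infty (snd (snd s)).
Proof.
intros Hk Hb. destruct (profile_exists b M L k c p Hk Hb) as [u [W Hs]].
destruct (profile_tail_exists b M L k c p u W Hk Hb Hs) as [lp Hlp].
destruct (profile_tail_exists (fun y => - b y) M L k c (- p) (fun x => u (- x))
  (fun x => W (- x)) Hk (bounded_lipschitz_opp b M L Hb)
  (picard_step_reflect b k c p u u W Hs)) as [lm Hlm].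
exists ((u, W), (lp, lm)). simpl. split; [|split]; auto.
- apply is_lim_of_exponential_tail with (1 := Hlp).
- apply is_lim_reflect. apply is_lim_of_exponential_tail with (1 := Hlm).
Qed.

Lemma profile_bvp_exists (b : R -> R) (M L k uL uR : R) :
  0 < k -> bounded_lipschitz b M L ->
  exists c p u W, profile b k c p u W /\ is_lim u m_infty uL /\ is_lim u p_infty uR.
Proof.
intros Hk Hb.
set (sol := fun c p => proj1_sig (constructive_indefinite_description _
  (profile_limits_exist b M L k c p Hk Hb))).
set (u := fun c p => fst (fst (sol c p))). set (W := fun c p => snd (fst (sol c p))).
set (Phi := fun c p => fst (snd (sol c p))). set (Psi := fun c p => snd (snd (sol c p))).
assert (Hs : forall c p, profile b k c p (u c p) (W c p) /\
  is_lim (u c p) p_infty (Phi c p) /\ is_lim (u c p) m_infty (Psi c p)).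
{ intros c p. exact (proj2_sig (constructive_indefinite_description _
    (profile_limits_exist b M L k c p Hk Hb))). }
clearbody Psi Phi W u. clear sol.
assert (Hstab : forall P, exists K, forall c1 c2 p1 p2 y, Rabs p1 <= P ->
  Rabs (u c1 p1 y - u c2 p2 y) <= K * (Rabs (c1 - c2) + Rabs (p1 - p2))).
{ intros P. exists (2 * (1 + gauss M k) * exp (2 * (P * L * gauss M k))).
  intros c1 c2 p1 p2 y HP.
  apply Rle_trans with (1 := profile_stability b M L k P c1 c2 p1 p2 _ _ _ _ y Hk Hb HP
    (proj1 (Hs c1 p1)) (proj1 (Hs c2 p2))).
  assert (A1 := Rabs_pos (c1 - c2)). assert (A2 := Rabs_pos (p1 - p2)).
  assert (A3 := gauss_pos M k).
  set (Q := exp (2 * (P * L * gauss M k))). assert (HQ : 0 < Q) by apply exp_pos.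
  replace (2 * (1 + gauss M k) * Q * (Rabs (c1 - c2) + Rabs (p1 - p2))) with
    (2 * ((1 + gauss M k) * (Rabs (c1 - c2) + Rabs (p1 - p2))) * Q) by ring.
  apply Rmult_le_compat_r; [lra|]. nra. }
destruct (shooting Phi Psi (exp (- M - k / 2)) uL uR) as (c & p & HR & HL).
- apply exp_pos.
- intros P. destruct (Hstab P) as [K HK]. exists K. intros c1 c2 p1 p2 HP.
  apply (lim_dist_le (u c1 p1) (u c2 p2) p_infty); auto; apply Hs.
- intros P. destruct (Hstab P) as [K HK]. exists K. intros c1 c2 p1 p2 HP.
  apply (lim_dist_le (u c1 p1) (u c2 p2) m_infty); auto; apply Hs.
- intros c p1 p2 Hp. destruct (Hs c p1) as (H1 & L1 & _). destruct (Hs c p2) as (H2 & L2 & _).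
  apply (profile_limit_strict_mono b M L k c p1 p2 _ _ _ _ _ _ Hk Hb H1 H2 L1 L2 Hp).
- intros c p Hp. destruct (Hs c p) as (H1 & L1 & _).
  rewrite <- (proj1 H1) at 1. apply (exp_slope_growth (u c p) (W c p)); auto.
  + apply H1.
  + intros z Hz. apply (profile_exponent_lower b M L k c p (u c p)); auto.
- intros c p Hp. destruct (Hs c p) as (H1 & L1 & _).
  assert (H : - u c p 0 + exp (- M - k / 2) * - p <= - Phi c p).
  { apply (exp_slope_growth (fun x => - u c p x) (W c p)); auto.
    + lra.
    + apply is_derive_exp_slope_opp, H1.
    + intros z Hz. apply (profile_exponent_lower b M L k c p (u c p)); auto.
    + apply (is_lim_opp (u c p) p_infty (Phi c p)), L1. }
  rewrite (proj1 H1) in H. lra.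
- intros c p Hp. destruct (Hs c p) as (H1 & L1 & L2).
  rewrite <- (proj1 H1) at 2.
  apply (exp_slope_limits_pos (u c p) (W c p) p _ (Phi c p)); auto. apply H1.
- intros c p Hp. destruct (Hs c p) as (H1 & L1 & L2).
  rewrite <- (proj1 H1) at 1.
  apply (exp_slope_limits_neg (u c p) (W c p) p _ (Phi c p)); auto. apply H1.
- exists c, p, (u c p), (W c p). rewrite <- HL, <- HR.
  destruct (Hs c p) as (H1 & L1 & L2). auto.
Qed.

(** * Clamping and the return to the original equation *)

Definition clamp (a b y : R) : R := Rmax a (Rmin b y).

Lemma clamp_between (a b y : R) : a <= b -> a <= clamp a b y <= b.
Proof.
intros H. unfold clamp. split; [apply Rmax_l|]. apply Rmax_lub; auto. apply Rmin_l.
Qed.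

Lemma clamp_id (a b y : R) : a <= y <= b -> clamp a b y = y.
Proof. intros H. unfold clamp. rewrite Rmin_right, Rmax_right; lra. Qed.

Lemma clamp_contracting (a b x y : R) : Rabs (clamp a b x - clamp a b y) <= Rabs (x - y).
Proof.
unfold clamp, Rmax, Rmin.
repeat destruct Rle_dec; unfold Rabs; repeat destruct Rcase_abs; lra.
Qed.

Lemma clamped_bounded_lipschitz (g : R -> R) (eps a b : R) :
  0 < eps -> a <= b -> lipschitz_on g a b ->
  exists M L, bounded_lipschitz (fun y => g (clamp a b y) / eps) M L.
Proof.
intros He Hab [L HL].
assert (HL0 := Rabs_pos L). assert (HL1 := Rle_abs L). assert (Hga := Rabs_pos (g a)).
assert (Hie : 0 < / eps) by (apply Rinv_0_lt_compat; auto).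
(* [lipschitz_on] admits a negative constant when [a = b], hence the passage to [Rabs L]. *)
assert (HL' : forall x y, a <= x <= b -> a <= y <= b ->
  Rabs (g x - g y) <= Rabs L * Rabs (x - y)).
{ intros x y Hx Hy. apply Rle_trans with (1 := HL x y Hx Hy).
  apply Rmult_le_compat_r; auto. apply Rabs_pos. }
exists ((Rabs (g a) + Rabs L * (b - a)) / eps), (Rabs L / eps).
split; [|split; [|split]].
- apply Rdiv_le_0_compat; auto. apply Rplus_le_le_0_compat; auto.
  apply Rmult_le_pos; lra.
- apply Rdiv_le_0_compat; auto.
- intros y. unfold Rdiv. rewrite Rabs_mult, (Rabs_pos_eq (/ eps)) by lra.
  apply Rmult_le_compat_r; [lra|].
  assert (Hc := clamp_between a b y Hab).
  assert (H := HL' (clamp a b y) a Hc ltac:(lra)).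
  rewrite (Rabs_pos_eq (_ - a)) in H by lra.
  assert (Ht := Rabs_triang (g (clamp a b y) - g a) (g a)).
  replace (g (clamp a b y) - g a + g a) with (g (clamp a b y)) in Ht by ring.
  nra.
- intros y z. replace (g (clamp a b y) / eps - g (clamp a b z) / eps) with
    ((g (clamp a b y) - g (clamp a b z)) * / eps) by (field; lra).
  rewrite Rabs_mult, (Rabs_pos_eq (/ eps)) by lra.
  replace (Rabs L / eps * Rabs (y - z)) with (Rabs L * Rabs (y - z) * / eps) by (field; lra).
  apply Rmult_le_compat_r; [lra|].
  apply Rle_trans with (1 := HL' _ _ (clamp_between a b y Hab) (clamp_between a b z Hab)).
  apply Rmult_le_compat_l; auto. apply clamp_contracting.
Qed.

Lemma profile_dafermos (f : R -> R) (eps uL uR c p : R) (u W : R -> R) :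
  is_C1 f -> 0 < eps ->
  profile (fun y => Derive f (clamp (Rmin uL uR) (Rmax uL uR) y) / eps) (/ eps) c p u W ->
  is_lim u m_infty uL -> is_lim u p_infty uR -> dafermos_solution f eps uL uR u.
Proof.
intros [_ Hf] He (_ & _ & Hu & HW) Hm Hp.
assert (Hid : forall x, clamp (Rmin uL uR) (Rmax uL uR) (u x) = u x).
{ intros x. apply clamp_id. apply (exp_slope_limits u W p); auto. }
assert (HDu : forall x, Derive u x = p * exp (W x))
  by (intros x; apply is_derive_unique; auto).
set (v := fun x => p * exp (W x) * (Derive f (u x) / eps - / eps * x)).
assert (HD2 : forall x, is_derive (Derive u) x (v x)).
{ intros x. apply (is_derive_ext (fun x => p * exp (W x))); [intros; auto|].
  unfold v. rewrite Rmult_assoc. apply (is_derive_scal (fun x => exp (W x))).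
  rewrite Rmult_comm.
  apply (is_derive_comp exp W); [apply is_derive_exp|].
  specialize (HW x). cbv beta in HW. rewrite Hid in HW. exact HW. }
assert (HDn : forall x, Derive_n u 2 x = v x).
{ intros x. apply (is_derive_unique (Derive u)). auto. }
assert (Hcu : forall x, continuous u x)
  by (intros x; apply (ex_derive_continuous u); eexists; apply Hu).
split; [split; [|split]|split; [|split]]; auto.
- intros x. eexists. apply Hu.
- intros x. eexists. apply HD2.
- intros x. apply (continuous_ext v); [intros; auto|].
  apply (continuous_mult (K:=R_AbsRing)).
  + apply (continuous_ext (Derive u)); [intros; auto|].
    apply (ex_derive_continuous (Derive u)). eexists. apply HD2.
  + apply (continuous_minus (V:=R_NormedModule)).
    * apply (continuous_mult (K:=R_AbsRing) (fun y => Derive f (u y)) (fun _ => / eps)).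
      -- apply (continuous_comp u (Derive f)); auto.
      -- apply continuous_const.
    * apply (ex_derive_continuous (fun y => / eps * y)). auto_derive; auto.
- intros x. rewrite HDn, HDu. unfold v. field. lra.
Qed.

(** With [W] a primitive of [f' (u) / eps - x / eps], the integrating factor makes [u' * exp (- W)]
    constant. Hence [u] is monotone and stays between its limits, so the clamp can be inserted
    afterwards. *)
Lemma dafermos_profile (f : R -> R) (eps uL uR : R) (u : R -> R) :
  is_C1 f -> 0 < eps -> dafermos_solution f eps uL uR u ->
  exists c p W,
    profile (fun y => Derive f (clamp (Rmin uL uR) (Rmax uL uR) y) / eps) (/ eps) c p u W.
Proof.
intros [_ Hf] He ((Hu1 & Hu2 & _) & Hode & Hm & Hp).
assert (Hcu : forall x, continuous u x) by (intros x; apply (ex_derive_continuous u); auto).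
set (V := fun x => Derive f (u x) / eps - / eps * x).
assert (HV : forall x, continuous V x).
{ intros x. apply (continuous_minus (V:=R_NormedModule)).
  - apply (continuous_mult (K:=R_AbsRing) (fun y => Derive f (u y)) (fun _ => / eps)).
    + apply (continuous_comp u (Derive f)); auto.
    + apply continuous_const.
  - apply (ex_derive_continuous (fun y => / eps * y)). auto_derive; auto. }
set (W := fun x => RInt V 0 x).
assert (HW : forall x, is_derive W x (V x)) by (intros x; apply is_derive_primitive; auto).
assert (HW0 : W 0 = 0) by (unfold W; rewrite RInt_point; reflexivity).
assert (HD2 : forall x, is_derive (Derive u) x (V x * Derive u x)).
{ intros x. replace (V x * Derive u x) with (Derive (Derive u) x).
  - apply Derive_correct. auto.
  - specialize (Hode x). change (Derive_n u 2 x) with (Derive (Derive u) x) in Hode.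
    apply Rmult_eq_reg_l with eps; [|lra]. rewrite Hode. unfold V. field. lra. }
set (h := fun x => Derive u x * exp (- W x)).
assert (Hh : forall x, is_derive h x 0).
{ intros x.
  replace 0 with (plus (mult (V x * Derive u x) (exp (- W x)))
    (mult (Derive u x) (- V x * exp (- W x))))
    by (unfold plus, mult; simpl; unfold mult; simpl; ring).
  apply (is_derive_mult (K:=R_AbsRing) (Derive u) (fun x => exp (- W x))).
  - apply HD2.
  - apply (is_derive_comp exp (fun x => - W x)); [apply is_derive_exp|].
    apply (is_derive_opp (V:=R_NormedModule)), HW.
  - intros; apply Rmult_comm. }
assert (HDu : forall x, is_derive u x (Derive u 0 * exp (W x))).
{ intros x. replace (Derive u 0 * exp (W x)) with (Derive u x); [apply Derive_correct; auto|].
  destruct (MVT_gen h 0 x (fun _ => 0)) as [z [_ Hz]].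
  - auto.
  - intros y _. apply continuity_pt_filterlim, (ex_derive_continuous h y).
    eexists. apply Hh.
  - rewrite Rmult_0_l in Hz. apply Rminus_diag_uniq in Hz. unfold h in Hz.
    rewrite HW0, Ropp_0, exp_0, Rmult_1_r in Hz. rewrite <- Hz.
    rewrite Rmult_assoc, <- exp_plus, Rplus_opp_l, exp_0. ring. }
exists (u 0), (Derive u 0), W. split; [|split; [|split]]; auto.
intros x. rewrite clamp_id.
- apply HW.
- apply (exp_slope_limits u W (Derive u 0)); auto.
Qed.

Theorem theorem1p1 (f : R -> R) (uL uR eps : R) :
  is_C1 f -> 0 < eps ->
  (uL <> uR -> lipschitz_on (Derive f) (Rmin uL uR) (Rmax uL uR)) ->
  exists! u : R -> R, dafermos_solution f eps uL uR u.
Proof.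
intros Hf He Hlip0.
assert (Hlip : lipschitz_on (Derive f) (Rmin uL uR) (Rmax uL uR)).
(* For equal end states the interval is a single point, where the constant 0 works. *)
{ destruct (Req_dec uL uR) as [->|]; auto.
  rewrite Rmin_left, Rmax_left by lra. exists 0. intros x y Hx Hy.
  replace y with x by lra. rewrite !Rminus_diag, Rabs_R0. lra. }
assert (Hab : Rmin uL uR <= Rmax uL uR) by (apply Rle_trans with uL; [apply Rmin_l | apply Rmax_l]).
destruct (clamped_bounded_lipschitz (Derive f) eps _ _ He Hab Hlip) as (M & L & Hb).
assert (Hk : 0 < / eps) by (apply Rinv_0_lt_compat; auto).
destruct (profile_bvp_exists _ M L (/ eps) uL uR Hk Hb) as (c & p & u & W & Hs & Hm & Hp).
exists u. split.
- apply (profile_dafermos f eps uL uR c p u W); auto.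
- intros v Hv. destruct (dafermos_profile f eps uL uR v Hf He Hv) as (c' & p' & W' & Hs').
  destruct Hv as (_ & _ & Hm' & Hp').
  apply functional_extensionality.
  apply (profile_bvp_unique _ M L (/ eps) c p c' p' uL uR u W v W' Hk Hb); auto.
Qed.
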